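(* Let $\mu$ be a probability measure on $\mathbb{R}$. Let $n\ge1$ and let $f_1,\dots,f_n:\mathbb{R}\to\mathbb{R}$ and $g_1,\dots,g_n:\mathbb{R}\to\mathbb{R}$ be functions in $L^2(\mu)$ such that both $(n+1)$-tuples $(1,f_1,\dots,f_n)$ and $(1,g_1,\dots,g_n)$ form Chebyshev systems. Then $$\det\big(\mathrm{Cov}_\mu(f_i,g_j)\big)_{1\le i,j\le n}\ \ge\ 0.$$
   Context: An $r$-tuple $(h_1,\dots,h_r)$ of functions $h_i:\mathbb{R}\to\mathbb{R}$ is said to form a Chebyshev system (of order $r$) if $\det(h_i(t_j))_{1\le i,j\le r}\ge0$ for all real numbers $t_1\le\dots\le t_r$ (the inequality is not required to be strict). $\mathrm{Cov}_\mu(f,g)=\int (f-\int f\,d\mu)(g-\int g\,d\mu)\,d\mu$; here $1$ denotes the constant function equal to $1$. *)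

(* Defs.v *)
From HB Require Import structures.
From mathcomp Require Import all_boot all_order all_algebra.
From mathcomp Require Import all_classical all_reals all_analysis.

Set Implicit Arguments.
Unset Strict Implicit.
Unset Printing Implicit Defensive.

Import Order.TTheory GRing.Theory Num.Theory.

Local Open Scope ring_scope.

(* The points t_j may coincide and the determinant may vanish: this is the weak
   (non-strict) form of the Chebyshev condition. *)
Definition chebyshev_system (R : realType) (r : nat) (h : r.-tuple (R -> R)) : Prop :=
  forall t : 'I_r -> R, {homo t : i j / (i <= j)%N >-> i <= j} ->
    0 <= \det (\matrix_(i < r, j < r) tnth h i (t j)).

(* The library's [covariance] takes values in [\bar R]; it is finite, so that
   [fine] loses nothing, when both functions are in L^2. *)
Definition cov_matrix (R : realType) (mu : probability (measurableTypeR R) R)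
    (n : nat) (f g : n.-tuple (R -> R)) : 'M[R]_n :=
  \matrix_(i < n, j < n) fine (covariance mu (tnth f i) (tnth g j)).

(* Main.v *)
Require Import Defs.
From HB Require Import structures.
From mathcomp Require Import all_boot all_order all_fingroup all_algebra.
From mathcomp Require Import all_classical all_reals all_analysis.

Import Order.TTheory GRing.Theory Num.Theory.

Local Open Scope ring_scope.

(** Put F = (1, f_1, .., f_n), G = (1, g_1, .., g_n) and let
    M = (E[F_a G_b]) be the moment matrix, of size m = n + 1.  Subtracting
    multiples of the first column of M clears its first row, and leaves the
    covariance matrix as the remaining block: M has determinant
    det (Cov(f_i, g_j)) ([det_bordered]).  So it suffices that det M >= 0.

    The classical reason is the Andreief (continuous Cauchy-Binet) identity
      m! det M = E[det (F_a(t_i)) det (G_a(t_i))],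
    the expectation being over m independent points t_i of law mu.  The
    integrand is nonnegative at every t: sorting t multiplies both determinants
    by the same sign, and for sorted t both are nonnegative by the Chebyshev
    property ([chebyshev_prod_ge0]).

    The proof below integrates out one point at a time, so that neither product
    measures nor Fubini's theorem enter.  The m-linear form [mixed_det] equals
    det (F_a(t_i)) det (G_a(t_i)) on the rank-one matrices (F_a(t_i) G_b(t_i)),
    and m! det M when all its arguments are M.  Since it is linear in the i-th
    argument, replacing (F_a(t_i) G_b(t_i)) by M amounts to taking the
    expectation of a finite combination of the functions F_a G_b, which
    preserves nonnegativity; m such replacements go from the first value to the
    second ([moment_det_ge0]). *)

(** * The mixed determinant *)

Section MixedDet.
Context {R : comPzRingType} {m : nat}.
Implicit Types (X : 'I_m -> 'M[R]_m) (A M : 'M[R]_m).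

(** This is m! times the polarization of the determinant.  Keeping both the
    sum over permutations and the determinant, which is redundant for a
    polarization, makes it factor visibly on rank-one arguments. *)
Definition mixed_det X : R :=
  \sum_(s : 'S_m) (-1) ^+ s * \det (\matrix_(i, j) X i (s i) j).

(** Permuting the rows of M by s gives a second sign of s, which cancels the
    one in the sum: every permutation contributes det M. *)
Lemma mixed_det_const M : mixed_det (fun=> M) = \det M *+ m`!.
Proof.
rewrite /mixed_det -card_Sn -sumr_const; apply: eq_bigr => s _.
have -> : \matrix_(i, j) M (s i) j = row_perm s M.
  by apply/matrixP => i j; rewrite !mxE.
by rewrite row_permE det_mulmx det_perm mulrA -signr_addb addbb mul1r.
Qed.

(** In the term of s the row i is the row i of v scaled by u_(i, s i): the
    scalars come out of the determinant and add up to the Leibniz formula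
    for u. *)
Lemma mixed_det_rank1 (u v : 'M[R]_m) :
  mixed_det (fun i => \matrix_(a, b) (u i a * v i b)) = \det u * \det v.
Proof.
rewrite /mixed_det [\det u]/determinant mulr_suml; apply: eq_bigr => s _.
have -> : \matrix_(i, j) (\matrix_(a, b) (u i a * v i b)) (s i) j
    = diag_mx (\row_i u i (s i)) *m v.
  by apply/matrixP => i j; rewrite mul_diag_mx !mxE.
rewrite det_mulmx det_diag mulrA; congr (_ * _ * _).
by apply: eq_bigr => i _; rewrite mxE.
Qed.

(** The coefficients are left abstract because only their independence of A
    matters: expanding along the row k, the only one that A enters, the
    cofactors depend on the other arguments alone. *)
Lemma mixed_det_linear X (k : 'I_m) :
  exists C : 'M[R]_m, forall A,
    mixed_det [eta X with k |-> A] = \sum_a \sum_b C a b * A a b.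
Proof.
pose B (s : 'S_m) := \matrix_(i, j) X i (s i) j.
exists (\matrix_(a, b)
  \sum_(s : 'S_m | s k == a) (-1) ^+ s * cofactor (B s) k b) => A.
rewrite /mixed_det (partition_big (fun s : 'S_m => s k) xpredT) //=.
apply: eq_bigr => a _; under eq_bigr do rewrite (expand_det_row _ k) mulr_sumr.
rewrite exchange_big; apply: eq_bigr => b _ /=; rewrite mxE mulr_suml.
apply: eq_bigr => s /eqP ska; rewrite mxE /= eqxx ska -mulrA.
congr (_ * _); rewrite mulrC; congr (_ * A a b).
rewrite /cofactor; congr (_ * \det _); apply/matrixP => i j.
by rewrite !mxE /= eq_sym (negPf (neq_lift _ _)).
Qed.

End MixedDet.

(** * Determinants of moment matrices *)

(** The hypothesis [Mpos] is all that is needed of an integral: M assigns to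
    the products F_a G_b values that extend to a positive linear functional on
    their span.  The point x0 only serves to know that T is inhabited. *)
Lemma moment_det_ge0 (R : realDomainType) (T : Type) (x0 : T) (m : nat)
    (F G : 'I_m -> T -> R) (M : 'M[R]_m)
    (Mpos : forall C : 'M[R]_m,
      (forall x, 0 <= \sum_a \sum_b C a b * (F a x * G b x)) ->
      0 <= \sum_a \sum_b C a b * M a b)
    (FGpos : forall t : 'I_m -> T,
      0 <= \det (\matrix_(i, j) F j (t i)) * \det (\matrix_(i, j) G j (t i))) :
  0 <= \det M.
Proof.
pose FG x := \matrix_(a, b) (F a x * G b x).
have mixed_ge0 k : (k <= m)%N -> forall t : 'I_m -> T,
    0 <= mixed_det (fun i : 'I_m => if (i < k)%N then M else FG (t i)).
  elim: k => [|k IHk] ltkm t.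
    rewrite [leRHS](_ : _ = mixed_det (fun i => \matrix_(a, b)
        ((\matrix_(i, j) F j (t i)) i a * (\matrix_(i, j) G j (t i)) i b))).
      by rewrite mixed_det_rank1.
    congr mixed_det; apply/funext => i.
    by apply/matrixP => a b; rewrite !mxE.
  pose X (i : 'I_m) := if (i < k)%N then M else FG (t i).
  have [C XC] := mixed_det_linear X (Ordinal ltkm).
  have -> : (fun i : 'I_m => if (i < k.+1)%N then M else FG (t i))
      = [eta X with Ordinal ltkm |-> M].
    by apply/funext => i; rewrite /X /= -val_eqE /= ltnS leq_eqVlt; case: eqP.
  (* The slot k is filled by M; positivity reduces this to filling it by the
     rank-one matrices FG x, that is, to moving the k-th point of t to x. *)
  rewrite XC; apply: Mpos => x.
  have := IHk (ltnW ltkm) [eta t with Ordinal ltkm |-> x].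
  have -> : (fun i : 'I_m => if (i < k)%N then M
        else FG ([eta t with Ordinal ltkm |-> x] i))
      = [eta X with Ordinal ltkm |-> FG x].
    apply/funext => i; rewrite /X /= -val_eqE /=.
    by case: eqP => // ->; rewrite ltnn.
  rewrite XC; congr (0 <= _); apply: eq_bigr => a _; apply: eq_bigr => b _.
  by rewrite mxE.
have := mixed_ge0 m (leqnn m) (fun=> x0).
have -> : (fun i : 'I_m => if (i < m)%N then M else FG x0) = (fun=> M).
  by apply/funext => i; rewrite ltn_ord.
by rewrite mixed_det_const pmulrn_lge0 // fact_gt0.
Qed.

(** * Products of Chebyshev determinants *)

Lemma exists_sorting_perm (disp : Order.disp_t) (T : orderType disp) (m : nat)
    (t : 'I_m -> T) :
  exists s : 'S_m, {homo t \o s : i j / (i <= j)%N >-> (i <= j)%O}.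
Proof.
pose u := [tuple t i | i < m].
have /tuple_permP[s us] : perm_eq (sort <=%O u) u by rewrite perm_sort.
exists s => i j leij.
have tE k : t (s k) = nth (t i) (sort <=%O u) k.
  by rewrite us (nth_map k) ?size_enum_ord // nth_ord_enum !tnth_mktuple.
rewrite /= !tE.
apply: (sorted_leq_nth le_trans le_refl) => //.
- by rewrite inE size_sort size_tuple ltn_ord.
- by rewrite inE size_sort size_tuple ltn_ord.
Qed.

(** One of the two determinants may well be negative for unsorted points, but
    then so is the other, unless one vanishes. *)
Lemma chebyshev_prod_ge0 (R : realType) (m : nat) (f g : m.-tuple (R -> R))
    (f_cheb : chebyshev_system f) (g_cheb : chebyshev_system g)
    (t : 'I_m -> R) :
  0 <= \det (\matrix_(i, j) tnth f j (t i)) *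
       \det (\matrix_(i, j) tnth g j (t i)).
Proof.
have [s ts] := exists_sorting_perm _ _ _ t.
have detE (h : m.-tuple (R -> R)) : \det (\matrix_(i, j) tnth h j (t i))
    = (-1) ^+ s * \det (\matrix_(i, j) tnth h i ((t \o s) j)).
  have -> : \matrix_(i, j) tnth h i ((t \o s) j)
      = (row_perm s (\matrix_(i, j) tnth h j (t i)))^T.
    by apply/matrixP => i j; rewrite !mxE.
  by rewrite det_tr row_permE det_mulmx det_perm mulrA -signr_addb addbb mul1r.
rewrite !detE mulrACA -signr_addb addbb mul1r.
by rewrite mulr_ge0 ?f_cheb ?g_cheb.
Qed.

(** * Moments of a probability measure *)

Lemma fine_expectation_linear_ge0 (d : measure_display) (T : measurableType d)
    (R : realType) (P : probability T R) (I : finType) (h : I -> T -> R) (c : I -> R)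
    (hL1 : forall i, h i \in Lfun P 1)
    (hpos : forall x, 0 <= \sum_i c i * h i x) :
  0 <= \sum_i c i * fine ('E_P[h i])%E.
Proof.
have hint i : P.-integrable setT (EFin \o h i) by exact/Lfun1_integrable.
rewrite -lee_fin -sumEFin.
have -> : (\sum_i (c i * fine 'E_P[h i])%:E)%E
    = (\int[P]_x \sum_i (c i * h i x)%:E)%E.
  rewrite integral_sum //; last first.
    by move=> i; exact: (integrableZl _ (c i) (hint i)).
  apply: eq_bigr => i _; under eq_integral do rewrite EFinM.
  rewrite (integralZl _ (hint i)) // EFinM fineK ?expectation_fin_num //.
  by rewrite unlock.
by apply: integral_ge0 => x _; rewrite sumEFin lee_fin.
Qed.

Lemma det_bordered (R : comNzRingType) (n : nat) (a : 'rV[R]_n) (b : 'cV[R]_n)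
    (A : 'M[R]_n) :
  \det (block_mx 1%:M a b A) = \det (A - b *m a).
Proof.
have -> : block_mx 1%:M a b A
    = block_mx 1%:M 0 b 1%:M *m block_mx 1%:M a 0 (A - b *m a).
  by rewrite mulmx_block !mul1mx !mul0mx !mulmx1 !addr0 addrC subrK.
by rewrite det_mulmx det_lblock det_ublock !det1 !mul1r.
Qed.

Lemma Lfun2_cons_cst (d : measure_display) (T : measurableType d)
    (R : realType) (P : probability T R) (n : nat) (f : n.-tuple (T -> R))
    (c : R) (fL2 : forall i, tnth f i \in Lfun P 2%:E) (i : 'I_n.+1) :
  tnth (cons_tuple (cst c) f) i \in Lfun P 2%:E.
Proof.
case: (unliftP ord0 i) => [j ->|->]; first by rewrite tnthS.
by rewrite tnth0; exact: Lfun_cst.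
Qed.

Theorem theorem4p2 (R : realType) (mu : probability (measurableTypeR R) R)
    (n : nat) (n_ge1 : (1 <= n)%N) (f g : n.-tuple (R -> R))
    (fL2 : forall i : 'I_n, tnth f i \in Lfun mu 2%:E)
    (gL2 : forall i : 'I_n, tnth g i \in Lfun mu 2%:E)
    (f_cheb : chebyshev_system (cons_tuple (cst 1) f))
    (g_cheb : chebyshev_system (cons_tuple (cst 1) g)) :
  0 <= \det (cov_matrix mu f g).
Proof.
have mufin : mu setT \is a fin_num by rewrite probability_setT.
have fL1 i : tnth f i \in Lfun mu 1 by exact: Lfun_subset12 (fL2 i).
have gL1 i : tnth g i \in Lfun mu 1 by exact: Lfun_subset12 (gL2 i).
have fgL1 i j : tnth f i * tnth g j \in Lfun mu 1 by exact: Lfun2_mul_Lfun1.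
pose F := tnth (cons_tuple (cst 1 : R -> R) f).
pose G := tnth (cons_tuple (cst 1 : R -> R) g).
have F2 i : F i \in Lfun mu 2%:E by exact: Lfun2_cons_cst.
have G2 i : G i \in Lfun mu 2%:E by exact: Lfun2_cons_cst.
pose M : 'M[R]_(1 + n) := \matrix_(a, b) fine ('E_mu[F a * G b])%E.
have ME : \det M = \det (cov_matrix mu f g).
  pose Ef : 'cV[R]_n := \col_i fine ('E_mu[tnth f i])%E.
  pose Eg : 'rV[R]_n := \row_j fine ('E_mu[tnth g j])%E.
  pose Efg : 'M[R]_n := \matrix_(i, j) fine ('E_mu[tnth f i * tnth g j])%E.
  have -> : M = block_mx 1%:M Eg Ef Efg.
    have one1 : cst 1 = 1 :> (R -> R) by [].
    have F0 (i : 'I_1) : F (lshift n i) = cst 1.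
      by rewrite ord1 /F (tnth_nth (cst 1)).
    have G0 (i : 'I_1) : G (lshift n i) = cst 1.
      by rewrite ord1 /G (tnth_nth (cst 1)).
    have FS i : F (rshift 1 i) = tnth f i by rewrite /F !(tnth_nth (cst 1)).
    have GS i : G (rshift 1 i) = tnth g i by rewrite /G !(tnth_nth (cst 1)).
    rewrite -[M]submxK; congr block_mx; apply/matrixP => i j; rewrite !mxE.
    - by rewrite F0 G0 one1 mulr1 -one1 expectation_cst !ord1.
    - by rewrite F0 GS one1 mul1r.
    - by rewrite FS G0 one1 mulr1.
    - by rewrite FS GS.
  rewrite det_bordered; congr (\det _); apply/matrixP => i j.
  rewrite !mxE big_ord1 !mxE covarianceE //.
  by rewrite fineB ?fineM ?fin_numM ?expectation_fin_num.
rewrite -ME; apply: (moment_det_ge0 _ _ 0 _ F G) => [C Cpos|t]; last first.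
  exact: chebyshev_prod_ge0.
rewrite pair_bigA /=.
under eq_bigr do rewrite mxE.
apply: (fine_expectation_linear_ge0 _ _ _ mu _ (fun p => F p.1 * G p.2)
  (fun p => C p.1 p.2)) => [p|x].
  exact: Lfun2_mul_Lfun1.
by have := Cpos x; rewrite pair_bigA.
Qed.
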